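(* For every pair of integers $m$ and $n$ with $3 \le m \le n$, we have $\chi'_{st}(C_m \,\square\, C_n) \le 7$.
   Context: A star edge-coloring of a graph $G$ is a proper edge-coloring of $G$ in which there is no bichromatic path and no bichromatic cycle of length four (i.e., with four edges). The star chromatic index $\chi'_{st}(G)$ is the minimum number of colors in a star edge-coloring of $G$. $C_m$ denotes the cycle on $m$ vertices. $G \,\square\, H$ denotes the Cartesian product: vertex set $V(G)\times V(H)$, with $(u,v)(u',v')$ an edge iff either $uu'\in E(G)$ and $v=v'$, or $u=u'$ and $vv'\in E(H)$. *)

(* Defs.v *)
From mathcomp Require Import all_boot.
From mathcomp Require Import boolp.

Set Implicit Arguments.
Unset Strict Implicit.
Unset Printing Implicit Defensive.

Record sgraph := SGraph {
  svertex :> finType;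
  sadj : rel svertex;
  sadj_sym : symmetric sadj;
  sadj_irr : irreflexive sadj
}.

Definition edges (G : sgraph) : {set {set G}} :=
  [set [set e.1; e.2] | e : G * G & sadj e.1 e.2].

Section CycleGraph.
Variable m : nat.

(* [ordS] is the successor modulo m; the test [i != j] only matters for m = 1. *)
Definition cycle_adj : rel 'I_m :=
  [rel i j | (i != j) && ((j == ordS i) || (i == ordS j))].

Lemma cycle_adj_sym : symmetric cycle_adj.
Proof. by move=> i j; rewrite /cycle_adj /= [i == j]eq_sym orbC. Qed.

Lemma cycle_adj_irr : irreflexive cycle_adj.
Proof. by move=> i; rewrite /cycle_adj /= eqxx. Qed.

Definition cycle_graph : sgraph := SGraph cycle_adj_sym cycle_adj_irr.

End CycleGraph.

Section CartesianProduct.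
Variables G H : sgraph.

Definition cart_adj : rel (G * H) :=
  [rel x y | (sadj x.1 y.1 && (x.2 == y.2)) || ((x.1 == y.1) && sadj x.2 y.2)].

Lemma cart_adj_sym : symmetric cart_adj.
Proof.
by move=> x y; rewrite /cart_adj /= [x.2 == _]eq_sym [x.1 == _]eq_sym ![sadj x.1 _]sadj_sym
  ![sadj x.2 _]sadj_sym.
Qed.

Lemma cart_adj_irr : irreflexive cart_adj.
Proof. by move=> x; rewrite /cart_adj /= !sadj_irr andbF. Qed.

Definition cart_prod : sgraph := SGraph cart_adj_sym cart_adj_irr.

End CartesianProduct.

Section StarEdgeColoring.
Variable G : sgraph.

(* An edge-coloring is a map on all vertex sets; only its values on [edges G]
   are ever used. *)
Implicit Type c : {set G} -> nat.

Definition proper_edge_coloring c : Prop :=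
  forall f g, f \in edges G -> g \in edges G ->
    f != g -> f :&: g != set0 -> c f <> c g.

Definition walk_edges (x : G) (p : seq G) : seq {set G} :=
  pairmap (fun y z => [set y; z]) x p.

Definition bichromatic c (s : seq {set G}) : bool :=
  size (undup (map c s)) == 2.

Definition bichromatic_path4 c (x : G) (p : seq G) : Prop :=
  [/\ path (@sadj G) x p, uniq (x :: p), size p = 4
    & bichromatic c (walk_edges x p)].

(* The closed walk x :: rcons p x has 4 edges when x :: p has 4 vertices. *)
Definition bichromatic_cycle4 c (x : G) (p : seq G) : Prop :=
  [/\ cycle (@sadj G) (x :: p), uniq (x :: p), size (x :: p) = 4
    & bichromatic c (walk_edges x (rcons p x))].

Definition star_edge_coloring c : Prop :=
  [/\ proper_edge_coloring c,
      forall x p, ~ bichromatic_path4 c x p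
    & forall x p, ~ bichromatic_cycle4 c x p].

Definition star_edge_colorable (k : nat) : Prop :=
  exists2 c, star_edge_coloring c & forall f, f \in edges G -> c f < k.

Lemma eq_set2 (a b x y : G) : [set a; b] = [set x; y] ->
  (a == x) || (a == y) /\ (b == x) || (b == y).
Proof.
move=> e; have := set21 a b; have := set22 a b.
by rewrite e !in_set2 => -> ->.
Qed.

Lemma ex_star_edge_colorable : exists k, `[< star_edge_colorable k >].
Proof.
exists #|{set G}|; apply/asboolP.
pose c (f : {set G}) : nat := nat_of_ord (enum_rank f).
exists c; last by move=> f _; exact: ltn_ord.
have inj_c : injective c by move=> f g /ord_inj /enum_rank_inj.
have bi s : bichromatic c s -> uniq s -> size s = 2.
  by move=> /eqP + us; rewrite undup_id ?map_inj_uniq // size_map.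
have ne2 (a b x y : G) : [&& a != x & a != y] || [&& b != x & b != y] ->
    ([set a; b] == [set x; y]) = false.
  move=> h; apply/negP => /eqP /eq_set2 [].
  by case/orP: h => /andP[/negbTE-> /negbTE->].
split.
- by move=> f g _ _ /eqP fg _ /inj_c.
- move=> x p [_ u sp /bi bp].
  move: p u sp bp => [|a [|b [|d [|z []]]]] // u _.
  suff -> : uniq (walk_edges x [:: a; b; d; z]) by move/(_ isT).
  move: u; rewrite /= !inE !negb_or -!andbA.
  move=> /and5P[n1 n2 n3 n4 /and5P[n5 n6 n7 n8 /and3P[n9 n10 _]]].
  rewrite !ne2 // ?n1 ?n2 ?n3 ?n4 ?n5 ?n6 ?n7 ?n8 ?n9 ?n10 ?orbT //.
- move=> x p [_ u sp /bi bp].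
  move: p u sp bp => [|a [|b [|d []]]] // u _.
  suff -> : uniq (walk_edges x [:: a; b; d; x]) by move/(_ isT).
  move: u; rewrite /= !inE !negb_or -!andbA.
  move=> /and5P[n1 n2 n3 n4 /and3P[n5 n6 _]].
  by rewrite !ne2 // ?[a == x]eq_sym ?[b == x]eq_sym ?[d == x]eq_sym
     ?[b == a]eq_sym ?[d == a]eq_sym ?[d == b]eq_sym
     ?n1 ?n2 ?n3 ?n4 ?n5 ?n6 ?orbT.
Qed.

Definition star_chromatic_index : nat := ex_minn ex_star_edge_colorable.

End StarEdgeColoring.

(* Main.v *)
Require Import Defs.
From mathcomp Require Import all_boot.
From mathcomp Require Import boolp zify.

Set Implicit Arguments.
Unset Strict Implicit.
Unset Printing Implicit Defensive.

(** Rows and columns of the torus are labelled by states 0..11 subject to a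
    successor relation: the blocks 0 1 2 and 3 4 5 6 may follow each other in
    any order, and 7 8 9 10 11 is repeated.  Cyclic words obeying the relation
    exist in every length at least 3: sums of 3s and 4s give all lengths but 5.
    An edge, oriented forward along its cycle, is coloured by its direction and
    the pair of states at its tail, through two 12 x 12 tables found by computer
    search.  In the torus a 4-edge path or 4-cycle is a walk that never
    backtracks, so the star condition follows from a finite check of all
    such walks of four steps between pairs of states. *)

(** * State graph, colour tables and the finite check *)

Definition succs (a : nat) : seq nat :=
  nth [::] [:: [:: 1]; [:: 2]; [:: 0; 3]; [:: 4]; [:: 5]; [:: 6]; [:: 0; 3];
               [:: 8]; [:: 9]; [:: 10]; [:: 11]; [:: 7]] a.

Definition preds (a : nat) : seq nat := [seq b <- iota 0 12 | a \in succs b].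

(** Rows are indexed by the state of the first coordinate, columns by that of the second; a
    horizontal edge is one that changes the first coordinate. *)
Definition hcolors : seq (seq nat) :=
  [:: [:: 3; 2; 1; 6; 6; 4; 1; 4; 1; 4; 2; 1];
      [:: 2; 1; 3; 2; 1; 2; 4; 0; 3; 5; 5; 6];
      [:: 1; 3; 2; 1; 0; 6; 5; 1; 6; 6; 4; 0];
      [:: 3; 2; 1; 3; 6; 3; 1; 3; 1; 4; 2; 1];
      [:: 0; 3; 6; 4; 1; 0; 3; 0; 3; 0; 0; 4];
      [:: 6; 5; 3; 6; 3; 1; 0; 3; 0; 2; 6; 1];
      [:: 1; 6; 2; 1; 0; 6; 5; 1; 2; 1; 4; 0];
      [:: 5; 6; 4; 5; 4; 5; 4; 2; 3; 4; 5; 5];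
      [:: 0; 2; 2; 0; 2; 6; 3; 5; 6; 6; 6; 6];
      [:: 3; 0; 1; 3; 5; 1; 5; 0; 0; 0; 4; 4];
      [:: 6; 3; 2; 6; 3; 3; 2; 2; 1; 4; 6; 3];
      [:: 2; 5; 3; 2; 6; 2; 6; 4; 5; 5; 1; 1]].

Definition vcolors : seq (seq nat) :=
  [:: [:: 4; 5; 0; 4; 5; 2; 0; 5; 0; 3; 6; 2];
      [:: 0; 4; 5; 3; 0; 3; 5; 6; 2; 0; 3; 5];
      [:: 5; 0; 4; 5; 3; 0; 6; 4; 2; 1; 2; 3];
      [:: 4; 5; 0; 4; 5; 2; 0; 5; 0; 3; 6; 2];
      [:: 6; 4; 5; 0; 2; 4; 5; 4; 2; 5; 3; 6];
      [:: 4; 1; 2; 0; 5; 6; 2; 5; 6; 1; 3; 2];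
      [:: 3; 0; 4; 5; 2; 3; 4; 4; 3; 5; 2; 6];
      [:: 4; 0; 1; 3; 0; 3; 1; 1; 2; 0; 4; 6];
      [:: 1; 3; 6; 1; 3; 0; 2; 0; 2; 1; 2; 3];
      [:: 4; 5; 6; 4; 0; 2; 1; 4; 5; 3; 0; 1];
      [:: 2; 5; 4; 2; 0; 6; 4; 3; 2; 1; 5; 6];
      [:: 1; 6; 0; 1; 4; 1; 0; 0; 6; 3; 2; 5]].

(* A direction is a pair (horizontal?, forward?). *)
Definition dir : Type := bool * bool.

Definition opp (d : dir) : dir := (d.1, ~~ d.2).

Definition dirs : seq dir :=
  [:: (true, true); (true, false); (false, true); (false, false)].

Lemma mem_dirs (d : dir) : d \in dirs.
Proof. by case: d => [[] []]. Qed.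

Definition moves (d : dir) (p : nat * nat) : seq (nat * nat) :=
  let next a := if d.2 then succs a else preds a in
  if d.1 then [seq (a, p.2) | a <- next p.1] else [seq (p.1, a) | a <- next p.2].

Definition state_color (h : bool) (p : nat * nat) : nat :=
  nth 0 (nth [::] (if h then hcolors else vcolors) p.1) p.2.

(** A backward step from [p] to [q] has its tail at [q], so an edge gets the same colour whichever
    way it is traversed. *)
Definition move_color (d : dir) (p q : nat * nat) : nat :=
  state_color d.1 (if d.2 then p else q).

Definition states : seq (nat * nat) :=
  [seq (a, b) | a <- iota 0 12, b <- iota 0 12].

Definition turns (d : dir) : seq dir := [seq e <- dirs | e != opp d].

Definition all_moves (D : seq dir) (p : nat * nat)
    (P : dir -> nat * nat -> nat -> bool) : bool :=
  all (fun d => all (fun q => P d q (move_color d p q)) (moves d p)) D.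

Lemma all_movesP D p P d q : all_moves D p P -> d \in D -> q \in moves d p ->
  P d q (move_color d p q).
Proof. by move=> /allP h /h /allP hd /hd. Qed.

(** Once consecutive colours differ, four steps use only two colours exactly when [c1 = c3] and
    [c2 = c4]; hence the fourth step is explored only if [c1 = c3]. Closing up is never tested, so
    4-paths and 4-cycles are covered together. *)
Definition star_check : bool :=
  all (fun p0 =>
    all_moves dirs p0 (fun d1 p1 c1 => (c1 < 7) &&
    all_moves (turns d1) p1 (fun d2 p2 c2 => (c1 != c2) &&
    all_moves (turns d2) p2 (fun d3 p3 c3 => (c1 == c3) ==>
    all_moves (turns d3) p3 (fun d4 p4 c4 => c2 != c4))))) states.

Lemma star_checkT : star_check.
Proof. by vm_compute. Qed.

Lemma mem_turns d e : e != opp d -> e \in turns d.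
Proof. by rewrite mem_filter mem_dirs andbT. Qed.

Section StateWalks.
Variables (d1 d2 d3 d4 : dir) (p0 p1 p2 p3 p4 : nat * nat).
Hypothesis sp0 : p0 \in states.
Hypotheses (mv1 : p1 \in moves d1 p0) (mv2 : p2 \in moves d2 p1)
  (mv3 : p3 \in moves d3 p2) (mv4 : p4 \in moves d4 p3).
Hypotheses (tn2 : d2 != opp d1) (tn3 : d3 != opp d2) (tn4 : d4 != opp d3).

Lemma move_color_lt7 : move_color d1 p0 p1 < 7.
Proof.
have /allP/(_ _ sp0) h := star_checkT.
by have /andP[] := all_movesP h (mem_dirs d1) mv1.
Qed.

Lemma move_color_proper : move_color d1 p0 p1 != move_color d2 p1 p2.
Proof.
have /allP/(_ _ sp0) h := star_checkT.
have /andP[_ {}h] := all_movesP h (mem_dirs d1) mv1.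
by have /andP[] := all_movesP h (mem_turns tn2) mv2.
Qed.

Lemma move_color_star : move_color d1 p0 p1 = move_color d3 p2 p3 ->
  move_color d2 p1 p2 != move_color d4 p3 p4.
Proof.
move=> c13; have /allP/(_ _ sp0) h := star_checkT.
have /andP[_ {}h] := all_movesP h (mem_dirs d1) mv1.
have /andP[_ {}h] := all_movesP h (mem_turns tn2) mv2.
have {h} := all_movesP h (mem_turns tn3) mv3.
by rewrite c13 eqxx => /= h; exact: (all_movesP h (mem_turns tn4) mv4).
Qed.

End StateWalks.

(** * Cyclic words of states of every length at least 3 *)

Definition succ_state : rel nat := [rel a b | b \in succs a].

(** Past its twelve rows the table defaults to the empty list. This is why [preds] loses nothing by
    searching only 0..11. *)
Lemma succ_state_ltl a b : succ_state a b -> a < 12.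
Proof.
apply: contraLR; rewrite -leqNgt => h.
have a0 : succs a = [::] by rewrite /succs nth_default.
by rewrite /succ_state /= a0.
Qed.

Lemma mem_preds a b : (b \in preds a) = succ_state b a.
Proof.
rewrite mem_filter mem_iota /=; apply: andb_idr => h.
exact: succ_state_ltl h.
Qed.

(** Blocks end in 2 or 6, which have the same successors, so a word that may follow 2 and ends in 2
    or 6 can be prefixed by a block or closed into a cycle. The induction prefixes 0 1 2. *)
Lemma block_word m : 3 <= m -> m != 5 ->
  exists w, [/\ size w = m, path succ_state 2 w & last 2 w \in [:: 2; 6]].
Proof.
elim/ltn_ind: m => m IHm m3 m5.
have [->|m_neq3] := eqVneq m 3; first by exists [:: 0; 1; 2].
have [->|m_neq4] := eqVneq m 4; first by exists [:: 3; 4; 5; 6].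
(* Removing 3 from 8 would leave the excluded length 5, so 8 is built as 4 + 4. *)
have [->|m_neq8] := eqVneq m 8; first by exists [:: 3; 4; 5; 6; 3; 4; 5; 6].
case: m m3 m5 m_neq3 m_neq4 m_neq8 IHm => [|[|[|m]]] // _ m5 m3 m4 m8 IHm.
have [w [sw pw lw]] : exists w,
    [/\ size w = m, path succ_state 2 w & last 2 w \in [:: 2; 6]].
  by apply: IHm; lia.
by exists [:: 0, 1, 2 & w]; rewrite /= sw.
Qed.

Lemma cyclic_state_word m : 3 <= m ->
  exists2 w, size w = m & cycle succ_state w.
Proof.
(* Length 5 is the separate cycle 7 8 9 10 11. *)
move=> m3; have [->|m5] := eqVneq m 5; first by exists (iota 7 5).
have [[|x p] [sw pw lw]] := block_word m3 m5; first by rewrite -sw in m3.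
exists (x :: p) => //; move: pw lw; rewrite /= rcons_path => /andP[x2 ->] /=.
by rewrite !inE => /orP[] /eqP ->.
Qed.

Lemma cycle_nth_ordS (T : eqType) (e : rel T) x0 (w : seq T) (i : 'I_(size w)) :
  cycle e w -> e (nth x0 w i) (nth x0 w (ordS i)).
Proof.
case: w i => [|x p] i //=; first by case: i.
move=> /(pathP x0)/(_ i); rewrite size_rcons => /(_ (ltn_ord i)).
rewrite -rcons_cons nth_rcons ltn_ord nth_rcons.
have := ltn_ord i; rewrite [_ < _]/= ltnS leq_eqVlt => /orP[/eqP ip|ip].
  by rewrite ip ltnn eqxx modnn.
by rewrite ip modn_small.
Qed.

Lemma cyclic_states m : 3 <= m ->
  exists s : 'I_m -> nat, forall i, succ_state (s i) (s (ordS i)).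
Proof.
move=> /cyclic_state_word[w <- cw]; exists (fun i => nth 0 w i) => i.
exact: cycle_nth_ordS.
Qed.

(** * Successors on a cycle and orientation of the torus edges *)

Lemma ordS_neq m (i : 'I_m) : 1 < m -> ordS i != i.
Proof.
move=> m1; apply/eqP => /(congr1 val) /=; have := ltn_ord i.
rewrite leq_eqVlt => /orP[/eqP im|im]; first by rewrite im modnn; lia.
by rewrite modn_small //; lia.
Qed.

(** Ensures that no edge is forward in both senses, as would happen on a cycle of length 2. *)
Lemma ordS_ordS_neq m (i : 'I_m) : 2 < m -> ordS (ordS i) != i.
Proof.
move=> m2; apply/eqP => /(congr1 val) /=; have := ltn_ord i.
rewrite leq_eqVlt => /orP[/eqP im|im].
  by rewrite im modnn modn_small; lia.
rewrite (modn_small im); move: im; rewrite leq_eqVlt => /orP[/eqP im|im].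
  by rewrite im modnn; lia.
by rewrite modn_small //; lia.
Qed.

Section Torus.
Variables m n : nat.
Hypotheses (m3 : 2 < m) (n3 : 2 < n).

Local Notation torus := (cart_prod (cycle_graph m) (cycle_graph n)).
Implicit Types x y z : torus.

Definition forward (h : bool) x y : bool :=
  if h then (y.1 == ordS x.1) && (x.2 == y.2)
  else (x.1 == y.1) && (y.2 == ordS x.2).

Definition arc (d : dir) x y : bool :=
  if d.2 then forward d.1 x y else forward d.1 y x.

Lemma sadj_arc x y : sadj x y -> exists d, arc d x y.
Proof.
case/orP=> [/andP[/andP[_ /orP[] e1] e2]|/andP[e1 /andP[_ /orP[] e2]]].
- by exists (true, true); rewrite /arc /= e1 e2.
- by exists (true, false); rewrite /arc /= e1 eq_sym e2.
- by exists (false, true); rewrite /arc /= e1 e2.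
- by exists (false, false); rewrite /arc /= e2 eq_sym e1.
Qed.

(** [ordS] is injective, so a reversed direction retraces the edge just used. Contraposed, a walk
    that does not backtrack makes only the turns allowed by [turns]. *)
Lemma arc_opp d x y z : arc d x y -> arc (opp d) y z -> x = z.
Proof.
have inj k := bij_inj (ordS_bij k).
case: d x y z => [[] []] [x1 x2] [y1 y2] [z1 z2] /andP[/= /eqP-> /eqP->].
- by case/andP=> /= /eqP/inj-> /eqP->.
- by case/andP=> /= /eqP-> /eqP->.
- by case/andP=> /= /eqP-> /eqP/inj->.
- by case/andP=> /= /eqP-> /eqP->.
Qed.

Lemma forward_neq h x y : forward h x y -> x != y.
Proof.
case: h x y => [] [x1 x2] [y1 y2] /andP[/= /eqP e1 /eqP e2]; apply/eqP => -[].
  by rewrite e1 => /esym/eqP; rewrite (negbTE (ordS_neq _ (ltnW m3))).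
by rewrite e2 => _ /esym/eqP; rewrite (negbTE (ordS_neq _ (ltnW n3))).
Qed.

Lemma forward_dir h k x y : forward h x y -> forward k x y -> h = k.
Proof.
move=> fh fk; have := forward_neq fh.
case: h k x y fh fk => [] [] [x1 x2] [y1 y2] //= /andP[/= /eqP e1 /eqP e2].
  by case/andP=> /= /eqP-> _; rewrite e2 eqxx.
by case/andP=> /= _ /eqP->; rewrite e1 eqxx.
Qed.

Lemma forward_asym h k x y : forward h x y -> forward k y x -> False.
Proof.
move=> fh fk; have := forward_neq fh.
case: h k x y fh fk => [] [] [x1 x2] [y1 y2] //= /andP[/= /eqP e1 /eqP e2].
- by case/andP=> /= /eqP + _ _; rewrite e1 => /esym/eqP; rewrite (negbTE (ordS_ordS_neq _ m3)).
- by case/andP=> /= /eqP-> _; rewrite e2 eqxx.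
- by case/andP=> /= _ /eqP->; rewrite e1 eqxx.
- by case/andP=> /= _ /eqP + _; rewrite e2 => /esym/eqP; rewrite (negbTE (ordS_ordS_neq _ n3)).
Qed.

Lemma forward_inj h k x y x' y' : forward h x y -> forward k x' y' ->
  [set x; y] = [set x'; y'] -> h = k /\ x = x'.
Proof.
move=> f1 f2 /[dup] /eq_set2[] /orP[] /eqP ex /orP[] /eqP ey _; subst x y.
- by have := forward_neq f1; rewrite eqxx.
- by rewrite (forward_dir f1 f2).
- by case: (forward_asym f1 f2).
- by have := forward_neq f1; rewrite eqxx.
Qed.

(** * The colouring of the torus induced by the states *)

Variables (s : 'I_m -> nat) (t : 'I_n -> nat).
Hypothesis s_succ : forall i, succ_state (s i) (s (ordS i)).
Hypothesis t_succ : forall i, succ_state (t i) (t (ordS i)).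

Definition state x : nat * nat := (s x.1, t x.2).

Lemma mem_state x : state x \in states.
Proof.
apply/allpairsP; exists (state x); split=> //; rewrite mem_iota /=.
  exact: succ_state_ltl (s_succ _).
exact: succ_state_ltl (t_succ _).
Qed.

Lemma arc_moves d x y : arc d x y -> state y \in moves d (state x).
Proof.
case: d x y => [[] []] [x1 x2] [y1 y2] /andP[/= /eqP-> /eqP->];
  rewrite /moves /state /=; apply: map_f.
- exact: s_succ.
- by rewrite mem_preds s_succ.
- exact: t_succ.
- by rewrite mem_preds t_succ.
Qed.

(** The choice made by [pick] is harmless, since [forward_inj] makes direction and tail unique; the
    default 0 is taken only on sets that are not edges. *)
Definition torus_color (f : {set torus}) : nat :=
  if [pick e : bool * (torus * torus) |
       forward e.1 e.2.1 e.2.2 && (f == [set e.2.1; e.2.2])] is Some e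
  then state_color e.1 (state e.2.1) else 0.

Lemma torus_color_forward h x y :
  forward h x y -> torus_color [set x; y] = state_color h (state x).
Proof.
rewrite /torus_color => f1.
case: pickP => [[k [x' y']] /= /andP[f2 /eqP e]|/(_ (h, (x, y)))] /=.
  by have [-> ->] := forward_inj f1 f2 e.
by rewrite f1 eqxx.
Qed.

Lemma torus_color_arc d x y :
  arc d x y -> torus_color [set x; y] = move_color d (state x) (state y).
Proof.
case: d => [h []]; rewrite /arc /move_color /= => f1.
  exact: torus_color_forward.
by rewrite setUC; exact: torus_color_forward.
Qed.

Lemma torus_color_neq x y z : sadj x y -> sadj y z -> x != z ->
  torus_color [set x; y] != torus_color [set y; z].
Proof.
move=> /sadj_arc[d1 a1] /sadj_arc[d2 a2] xz.
rewrite (torus_color_arc a1) (torus_color_arc a2).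
apply: (move_color_proper (mem_state x) (arc_moves a1) (arc_moves a2)).
by apply: contraNneq xz => e; rewrite e in a2; rewrite (arc_opp a1 a2).
Qed.

(** Only backtracking is excluded, so [x4 = x0] is allowed and the result serves both paths and
    4-cycles. *)
Lemma torus_color_walk x0 x1 x2 x3 x4 :
  path (@sadj torus) x0 [:: x1; x2; x3; x4] ->
  x0 != x2 -> x1 != x3 -> x2 != x4 ->
  ~~ bichromatic torus_color (walk_edges x0 [:: x1; x2; x3; x4]).
Proof.
rewrite /= andbT => /and4P[e1 e2 e3 e4] n02 n13 n24.
have c12 := torus_color_neq e1 e2 n02.
have c23 := torus_color_neq e2 e3 n13.
have c34 := torus_color_neq e3 e4 n24.
have star : torus_color [set x0; x1] = torus_color [set x2; x3] ->
    torus_color [set x1; x2] != torus_color [set x3; x4].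
  move: (e1) (e2) (e3) (e4) => /sadj_arc[d1 a1] /sadj_arc[d2 a2].
  move=> /sadj_arc[d3 a3] /sadj_arc[d4 a4].
  have turn d e x y z : arc d x y -> arc e y z -> x != z -> e != opp d.
    by move=> ad ae; apply: contraNneq => de; rewrite de in ae; rewrite (arc_opp ad ae).
  rewrite (torus_color_arc a1) (torus_color_arc a2).
  rewrite (torus_color_arc a3) (torus_color_arc a4).
  exact: (move_color_star (mem_state x0) (arc_moves a1) (arc_moves a2)
    (arc_moves a3) (arc_moves a4) (turn _ _ _ _ _ a1 a2 n02)
    (turn _ _ _ _ _ a2 a3 n13) (turn _ _ _ _ _ a3 a4 n24)).
(* What remains concerns four numbers, consecutive ones distinct: they take exactly two values only
   by alternating, which [star] forbids. *)
rewrite /bichromatic /=; move: c12 c23 c34 star.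
move: (torus_color _) (torus_color _) (torus_color _) (torus_color _).
move=> c4 c3 c2 c1 c12 c23 c34 star; rewrite !inE.
rewrite (negbTE c12) (negbTE c23) (negbTE c34) /=.
have [c13|c13] := eqVneq c1 c3; first by rewrite (negbTE (star c13)).
have [<-|c24] := eqVneq c2 c4; first by rewrite (negbTE c12).
by case: ifP.
Qed.

Lemma torus_color_proper : proper_edge_coloring torus_color.
Proof.
have edge_at f z : f \in edges torus -> z \in f ->
    exists2 y, sadj y z & f = [set y; z].
  case/imsetP=> -[x y] /=; rewrite inE /= => e ->; rewrite !inE.
  case/orP=> /eqP->; last by exists x.
  by exists y; [exact: etrans (@sadj_sym torus _ _) e | rewrite setUC].
move=> f g fE gE fg /set0Pn[z /setIP[zf zg]].
(* The two edges meeting at [z] form the walk [y], [z], [x], and [f != g] gives [y != x]. *)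
have [y yz f_eq] := edge_at f z fE zf; have [x xz g_eq] := edge_at g z gE zg.
apply/eqP; rewrite f_eq g_eq [[set x; z]]setUC; apply: torus_color_neq => //.
  exact: etrans (@sadj_sym torus _ _) xz.
by apply: contraNneq fg => yx; rewrite f_eq g_eq yx.
Qed.

Lemma torus_color_star : star_edge_coloring torus_color.
Proof.
split; first exact: torus_color_proper.
- move=> x0 p [pth u sp]; apply/negP.
  case: p sp pth u => [|x1 [|x2 [|x3 [|x4 []]]]] // _ pth u.
  move: u; rewrite /= !inE !negb_or => /and5P[/and4P[_ n02 _ _] /and3P[_ n13 _]].
  by case/andP=> _ n24 _ _; apply: torus_color_walk.
- move=> x0 p [pth u sp]; apply/negP.
  case: p sp pth u => [|x1 [|x2 [|x3 []]]] // _ pth u.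
  move: u; rewrite /= !inE !negb_or => /and4P[/and3P[_ n02 _] /andP[_ n13] _ _].
  (* The walk closes at [x0], so its last non-backtracking condition is [x2 != x0]. *)
  by apply: torus_color_walk => //; rewrite eq_sym.
Qed.

Lemma torus_color_lt7 f : f \in edges torus -> torus_color f < 7.
Proof.
case/imsetP=> -[x y]; rewrite inE /= => /sadj_arc[d a] ->.
rewrite (torus_color_arc a); exact: move_color_lt7 (mem_state x) (arc_moves a).
Qed.

End Torus.

Theorem theorem20 (m n : nat) (hm : 3 <= m) (hmn : m <= n) :
  star_chromatic_index (cart_prod (cycle_graph m) (cycle_graph n)) <= 7.
Proof.
have hn := leq_trans hm hmn.
have [s s_succ] := cyclic_states hm; have [t t_succ] := cyclic_states hn.
rewrite /star_chromatic_index; case: ex_minnP => k _; apply; apply/asboolP.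
exists (torus_color s t); first exact: torus_color_star.
exact: torus_color_lt7.
Qed.
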